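(* Let $D$ be a dissection diagram of degree $n\ge 1$, let $i,j\in\{1,\dots,n\}$, $t_1\in\{0,\dots,f_D(i)\}$, $t_2\in\{0,\dots,f_D(j)\}$, $\tau_1,\tau_2\in\{0,\dots,f_D(0)\}$ and $\lambda_1,\lambda_2\in\{0,1\}$. Then: 1. $(\Phi_{i,t_1}(D),\{i,i+1\})=(\Phi_{j,t_2}(D),\{j,j+1\})$ if and only if $i=j$ and $t_1=t_2$; 2. $(\Phi^{\lambda_1}_{0,\tau_1}(D),\{0,(1-\lambda_1)n+1\})=(\Phi^{\lambda_2}_{0,\tau_2}(D),\{0,(1-\lambda_2)n+1\})$ if and only if $\lambda_1=\lambda_2$ and $\tau_1=\tau_2$; 3. $(\Phi_{i,t_1}(D),\{i,i+1\})\neq(\Phi^{\lambda_1}_{0,\tau_1}(D),\{0,(1-\lambda_1)n+1\})$.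
   Context: Dissection diagrams. For $n\ge 0$ let $\Pi_n$ be the regular $(n+1)$-gon with vertices $0,1,\dots,n$ numbered clockwise; vertex $0$ is the root. A chord $\{u,v\}$ is a segment joining two distinct vertices (adjacent vertices are allowed). A dissection diagram of degree $n$ is a set of $n$ pairwise non-crossing chords (they may share endpoints) of $\Pi_n$ forming an acyclic graph, hence a spanning tree on $\{0,\dots,n\}$. Chords at a vertex. For a vertex $i$ of $D$, the fertility $f_D(i)$ is the number of chords having $i$ as an endpoint. These chords are listed as $a^i_{D,1},\dots,a^i_{D,f_D(i)}$ in the order in which their other endpoints are met in the sequence $i-1,i-2,\dots,0,n,n-1,\dots,i+1$ (for $i=0$: $n,n-1,\dots,1$). Insertion of a chord. Let $D$ have degree $n\ge1$. - For $1\le i\le n$, $0\le t\le f_D(i)$, $\Phi_{i,t}(D)$ is the dissection diagram of degree $n+1$ whose chords are $\{i,i+1\}$ and the images of the chords of $D$ under: an endpoint $u<i$ stays $u$; an endpoint $u>i$ becomes $u+1$; the endpoint $i$ of a chord stays $i$ if the chord is one of $a^i_{D,1},\dots,a^i_{D,t}$ and becomes $i+1$ otherwise. - For $0\le\tau\le f_D(0)$, $\Phi^0_{0,\tau}(D)$ is the dissection diagram of degree $n+1$ whose chords are $\{0,n+1\}$ and the images of the chords of $D$ under: nonzero endpoints are unchanged; the endpoint $0$ becomes $n+1$ for the chords $a^0_{D,1},\dots,a^0_{D,\tau}$ and stays $0$ otherwise. - For $0\le\tau\le f_D(0)$, $\Phi^1_{0,\tau}(D)$ is the dissection diagram of degree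 $n+1$ whose chords are $\{0,1\}$ and the images of the chords of $D$ under: an endpoint $v\ge1$ becomes $v+1$; the endpoint $0$ stays $0$ for the chords $a^0_{D,1},\dots,a^0_{D,\tau}$ and becomes $1$ otherwise. *)

(* Defs.v *)
From mathcomp Require Import all_boot.
Set Implicit Arguments.
Unset Strict Implicit.
Unset Printing Implicit Defensive.

(* The vertices of the (n+1)-gon are 'I_n.+1, numbered clockwise, with root
   ord0.  A chord is the two-element set of its endpoints, and a diagram is
   given by its set of chords. *)
Section Diagrams.

Variable n : nat.
Implicit Types (D : {set {set 'I_n.+1}}) (i u v : 'I_n.+1) (t : nat).

(* Chords of a convex polygon cross, i.e. meet in an interior point of both,
   exactly when their endpoints strictly alternate around the boundary. *)
Definition noncrossing D : Prop :=
  forall a b c d : 'I_n.+1,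
    [set a; c] \in D -> [set b; d] \in D -> ~~ [&& a < b, b < c & c < d].

Definition adjacent D : rel 'I_n.+1 := [rel u v | [set u; v] \in D].

(* A ucycle of size 2 merely goes back and forth along one chord. *)
Definition acyclic D : Prop :=
  forall s : seq 'I_n.+1, ucycle (adjacent D) s -> size s <= 2.

Definition dissection_diagram D : Prop :=
  [/\ forall c, c \in D -> #|c| = 2, #|D| = n, noncrossing D & acyclic D].

Definition fertility D i : nat := #|[set c in D | i \in c]|.

(* i-1, ..., 0, n, ..., i+1 *)
Definition sweep i : seq 'I_n.+1 :=
  rev [seq v : 'I_n.+1 <- enum 'I_n.+1 | v < i] ++
  rev [seq v : 'I_n.+1 <- enum 'I_n.+1 | i < v].

(* The chord numbered k >= 1 in the mathematical text has index k - 1 here. *)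
Definition chords_at D i : seq {set 'I_n.+1} :=
  [seq [set i; v] | v <- sweep i & [set i; v] \in D].

Definition keep u : 'I_n.+2 := widen_ord (leqnSn n.+1) u.
Definition incr u : 'I_n.+2 := lift ord0 u.

Definition image_chords (f : {set 'I_n.+1} -> 'I_n.+1 -> 'I_n.+2) D :
    {set {set 'I_n.+2}} :=
  [set [set f c u | u in c] | c in D].

(* Meant for 1 <= i and t <= fertility D i. *)
Definition Phi D i t : {set {set 'I_n.+2}} :=
  [set keep i; incr i] |:
  image_chords (fun c u =>
    if u < i then keep u
    else if i < u then incr u
    else if c \in take t (chords_at D i) then keep i else incr i) D.

Definition Phi0_0 D t : {set {set 'I_n.+2}} :=
  [set ord0; ord_max] |:
  image_chords (fun c u =>
    if u != ord0 then keep u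
    else if c \in take t (chords_at D ord0) then ord_max else ord0) D.

Definition Phi0_1 D t : {set {set 'I_n.+2}} :=
  [set ord0; incr ord0] |:
  image_chords (fun c u =>
    if u != ord0 then incr u
    else if c \in take t (chords_at D ord0) then ord0 else incr ord0) D.

Definition Phi0 (lam : bool) D t : {set {set 'I_n.+2}} :=
  if lam then Phi0_1 D t else Phi0_0 D t.

(* {i, i+1} *)
Definition side_chord i : {set 'I_n.+2} := [set keep i; incr i].

(* {0, (1 - lam) n + 1} *)
Definition root_chord (lam : bool) : {set 'I_n.+2} :=
  [set ord0; inord ((1 - lam) * n + 1)].

End Diagrams.

Arguments root_chord : clear implicits.

(* Main.v *)
Require Import Defs.
From mathcomp Require Import all_boot.
Set Implicit Arguments.
Unset Strict Implicit.
Unset Printing Implicit Defensive.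

(** The marked chord alone tells the vertex and the kind of an insertion:
    [{i, i+1}] determines [i] and avoids the root when [1 <= i], while
    [{0, n+1}] and [{0, 1}] contain the root and differ because [1 <= n].
    What remains is that, at a given vertex and for a given kind, the diagram
    determines the cutting position [t].

    All three insertions do the same thing: a vertex [r] is doubled by inserting
    a new vertex [x] next to it, the old vertices being renumbered by [lift x];
    the new chord joins [x] to [lift x r], and the first [t] chords of [r] are
    moved to [x].  With [x] equal to [i], to [n+1] or to [0], this is [Phi],
    [Phi0_0] or [Phi0_1], so that [split] treats them at once.
    In the result, [{x, lift x v}], with [v] distinct from [r], is a chord
    exactly when [{r, v}] is one of the first [t] chords at [r] ([mem_split]).
    The diagram therefore determines the set of the first [t] chords; these are
    pairwise distinct and there are [t] of them, since [t] is at most the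
    fertility of [r] ([split_inj]). *)

Lemma set2_injr (T : finType) (x y z : T) :
  y != x -> [set x; y] = [set x; z] -> y = z.
Proof.
move=> yx /setP/(_ y); rewrite !inE eqxx orbT (negPf yx) /=.
by move=> /esym/eqP.
Qed.

(** * The chords at a vertex *)

Section ChordsAt.

Variable n : nat.
Implicit Types (D : {set {set 'I_n.+1}}) (r v : 'I_n.+1).

Lemma mem_sweep r v : (v \in sweep r) = (v != r).
Proof.
rewrite mem_cat !mem_rev (mem_filter (fun w : 'I_n.+1 => w < r)).
by rewrite (mem_filter (fun w : 'I_n.+1 => r < w)) mem_enum !andbT -neq_ltn.
Qed.

Lemma sweep_uniq r : uniq (sweep r).
Proof.
rewrite cat_uniq !rev_uniq !(filter_uniq _ (enum_uniq _)) /= andbT.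
apply/hasPn=> v; rewrite !mem_rev !mem_filter => /andP[rv _].
by rewrite ltnNge (ltnW rv).
Qed.

Lemma chords_atP D r c :
  reflect (exists2 v, v != r & c = [set r; v] /\ c \in D)
          (c \in chords_at D r).
Proof.
apply: (iffP mapP) => [[v]|[v vr [-> cD]]].
  by rewrite mem_filter mem_sweep => /andP[cD vr] ->; exists v.
by exists v; rewrite // mem_filter mem_sweep cD.
Qed.

Lemma chords_at_uniq D r : uniq (chords_at D r).
Proof.
rewrite map_inj_in_uniq ?filter_uniq ?sweep_uniq // => v w.
rewrite mem_filter mem_sweep => /andP[_ vr] _; exact: set2_injr.
Qed.

(** The sweep around [r] omits [r], so a degenerate chord [{r}] would be counted
    by the fertility but not listed; two-element chords exclude this. *)
Lemma size_chords_at D r :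
  (forall c, c \in D -> #|c| = 2) -> size (chords_at D r) = fertility D r.
Proof.
move=> D2; rewrite -(card_uniqP (chords_at_uniq D r)); apply: eq_card => c.
rewrite inE; apply/chords_atP/andP => [[v _ [-> cD]]|[cD rc]].
  by rewrite cD !inE eqxx.
have /eqP/cards2P[a [b [ab cE]]] := D2 c cD.
have: r \in [set a; b] by rewrite -cE.
rewrite !inE => /orP[] /eqP ->; first by exists b; rewrite 1?eq_sym.
by exists a; rewrite // setUC.
Qed.

End ChordsAt.

(** * Doubling a vertex *)

Section Split.

Variables (n : nat) (D : {set {set 'I_n.+1}}) (r : 'I_n.+1) (x : 'I_n.+2).
Implicit Types (c : {set 'I_n.+1}) (t : nat).

Definition split_end t c u :=
  if (u == r) && (c \in take t (chords_at D r)) then x else lift x u.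

Definition split t := [set x; lift x r] |: image_chords (split_end t) D.

Lemma split_end_eq_x t c u :
  split_end t c u = x -> c \in take t (chords_at D r).
Proof.
rewrite /split_end; case: ifP => [/andP[]// | _ /esym/eqP].
by rewrite (negPf (neq_lift _ _)).
Qed.

(** An image chord through [x] comes from one of the first [t] chords at [r], and
    its other end, lying in the image of [lift x], identifies that chord.  The
    new chord does not interfere, since it ends at [lift x r] and [v] is not
    [r]. *)
Lemma mem_split t v : v != r ->
  ([set x; lift x v] \in split t) = ([set r; v] \in take t (chords_at D r)).
Proof.
have lift_x w : lift x w != x by rewrite eq_sym neq_lift.
move=> vr; apply/idP/idP => [|ct].
  rewrite in_setU1 => /orP[/eqP/(set2_injr (lift_x v))/lift_inj v_r | ].
    by rewrite v_r eqxx in vr.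
  case/imsetP=> c _ cE.
  have: x \in [set x; lift x v] by rewrite !inE eqxx.
  rewrite cE => /imsetP[u _ /esym/split_end_eq_x ct].
  have /chords_atP[w wr [cw _]] := mem_take ct.
  have: split_end t c w \in [set x; lift x v].
    by rewrite cE imset_f // cw !inE eqxx orbT.
  rewrite /split_end (negPf wr) !inE (negPf (lift_x w)) /= => /eqP/lift_inj <-.
  by rewrite -cw.
have /chords_atP[_ _ [_ cD]] := mem_take ct.
apply/setU1P; right; apply/imsetP; exists [set r; v] => //.
by rewrite imsetU1 imset_set1 /split_end eqxx ct (negPf vr).
Qed.

Lemma split_inj t1 t2 :
  (forall c, c \in D -> #|c| = 2) ->
  t1 <= fertility D r -> t2 <= fertility D r ->
  split t1 = split t2 -> t1 = t2.
Proof.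
move=> D2; rewrite -size_chords_at // => le1 le2 eqS.
rewrite -(size_takel le1) -(size_takel le2).
apply/perm_size/uniq_perm; rewrite ?take_uniq ?chords_at_uniq // => c.
case: (boolP (c \in chords_at D r)) => [/chords_atP[v vr [-> _]] | cN].
  by rewrite -!mem_split // eqS.
by rewrite !(contraNF (@mem_take _ _ _ _) cN).
Qed.

End Split.

(** * The three insertions as doublings *)

Section Insertions.

Variables (n : nat) (D : {set {set 'I_n.+1}}).

Lemma eq_image_chords (f1 f2 : {set 'I_n.+1} -> 'I_n.+1 -> 'I_n.+2) :
  (forall c, f1 c =1 f2 c) -> image_chords f1 D = image_chords f2 D.
Proof.
move=> eqf; apply: eq_imset => c; apply: eq_imset; exact: eqf.
Qed.

Lemma lift_keep (i u : 'I_n.+1) :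
  lift (keep i) u = if u < i then keep u else incr u.
Proof. by apply: val_inj; rewrite /= /bump; case: (ltnP u i). Qed.

Lemma lift_ord_max (u : 'I_n.+1) : lift ord_max u = keep u.
Proof. by apply: val_inj; exact: lift_max. Qed.

Lemma Phi_split i t : Phi D i t = split D i (keep i) t.
Proof.
rewrite /Phi /split lift_keep ltnn; congr (_ |: _).
apply: eq_image_chords => c u; rewrite /split_end lift_keep -val_eqE /=.
by case: ltngtP => // /val_inj ->.
Qed.

Lemma Phi0_split lam t :
  Phi0 lam D t = split D ord0 (if lam then ord0 else ord_max) t.
Proof.
case: lam; first congr (_ |: _).
  by apply: eq_image_chords => c u; rewrite /split_end; case: eqP => //= ->.
have lift0 : lift ord_max ord0 = ord0 :> 'I_n.+2 by exact: val_inj.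
rewrite /split lift0 [X in X |: _]setUC; congr (_ |: _).
apply: eq_image_chords => c u.
by rewrite /split_end; case: eqP => [->|_] /=; rewrite ?lift0 ?lift_ord_max.
Qed.

End Insertions.

(** * The marked chords *)

Section MarkedChords.

Variable n : nat.

Lemma side_chord_inj : injective (@side_chord n).
Proof.
(* The smaller end i lies in {j, j+1}; exchanging i and j gives the converse. *)
have le_side (i j : 'I_n.+1) : side_chord i = side_chord j -> j <= i.
  move/setP/(_ (keep i)); rewrite !inE eqxx /= => /esym/orP[] /eqP/(congr1 val).
    by move=> /= ->.
  by rewrite /= /bump /= add1n => ->; rewrite leqnSn.
move=> i j eq_ij; apply/val_inj/eqP.
by rewrite eqn_leq (le_side _ _ eq_ij) (le_side _ _ (esym eq_ij)).
Qed.

Lemma root_chord_inj : 1 <= n -> injective (root_chord n).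
Proof.
move=> n_gt0.
have end_val (lam : bool) :
    (inord ((1 - lam) * n + 1) : 'I_n.+2) = (1 - lam) * n + 1 :> nat.
  by rewrite inordK //; case: lam; rewrite ?mul1n addn1.
move=> lam1 lam2 eq_lam.
have /(congr1 val) : (inord ((1 - lam1) * n + 1) : 'I_n.+2) =
    inord ((1 - lam2) * n + 1).
  by apply: set2_injr eq_lam; rewrite -val_eqE /= end_val addn1.
rewrite /= !end_val => /addIn/eqP; rewrite eqn_pmul2r //.
by case: lam1 lam2 {eq_lam} => [] [].
Qed.

Lemma side_chord_neq_root_chord (i : 'I_n.+1) lam :
  1 <= i -> side_chord i <> root_chord n lam.
Proof.
move=> i_gt0 /setP/(_ ord0); rewrite !inE eqxx /=.
by rewrite -!(inj_eq val_inj) /= eq_sym gtn_eqF.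
Qed.

End MarkedChords.

Theorem proposition36 (n : nat) (D : {set {set 'I_n.+1}}) (i j : 'I_n.+1)
    (t1 t2 tau1 tau2 : nat) (lam1 lam2 : bool)
    (hn : 1 <= n) (hD : dissection_diagram D)
    (hi : 1 <= i) (hj : 1 <= j)
    (ht1 : t1 <= fertility D i) (ht2 : t2 <= fertility D j)
    (htau1 : tau1 <= fertility D ord0) (htau2 : tau2 <= fertility D ord0) :
  [/\ (Phi D i t1, side_chord i) = (Phi D j t2, side_chord j)
        <-> i = j /\ t1 = t2,
      (Phi0 lam1 D tau1, root_chord n lam1) =
      (Phi0 lam2 D tau2, root_chord n lam2)
        <-> lam1 = lam2 /\ tau1 = tau2
    & (Phi D i t1, side_chord i) <> (Phi0 lam1 D tau1, root_chord n lam1)].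
Proof.
have [D2 _ _ _] := hD; split.
- split=> [[eq_diag /side_chord_inj eq_ij] | [-> ->] //]; split=> //.
  move: eq_diag ht2; rewrite -eq_ij !Phi_split => eq_diag ht2.
  exact: split_inj eq_diag.
- split=> [[eq_diag /(root_chord_inj hn) eq_lam] | [-> ->] //]; split=> //.
  by move: eq_diag; rewrite -eq_lam !Phi0_split; apply: split_inj.
- by case=> _; apply: side_chord_neq_root_chord.
Qed.
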